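(* Let $n\ge 1$, let $P\subseteq[0,1]^n$ be a convex set with $\mathbf{0}\in P$, and let $F:[0,1]^n\to\mathbb{R}_{\ge 0}$ be a non-negative, differentiable, DR-submodular function with $F(\mathbf{0})=0$ that is $L$-smooth on $P$, i.e. $\|\nabla F(x)-\nabla F(y)\|\le L\|x-y\|$ for all $x,y\in P$. Let $x^*\in\arg\max_{x\in P}F(x)$. For an integer $T\ge 1$, run Algorithm FW-Dis (described in the context) for $T$ iterations. Then the point $x(t_T)$ satisfies \[ F(x(t_T))\ \ge\ \frac14 F(x^* )-O\!\left(\frac{nL}{\ln^2 T}\right), \] where the constant hidden in the $O(\cdot)$ is absolute (independent of $n$, $L$, $T$, $F$, $P$). Consequently, for any $\varepsilon>0$, $F(x(t_T))\ge \frac14 F(x^* )-\varepsilon$ after $T=O\!\left(e^{\sqrt{nL/\varepsilon}}\right)$ iterations.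
   Context: DR-submodularity: for all $x\le y$ in $[0,1]^n$ (coordinatewise), all $i\in\{1,\dots,n\}$ and all $a>0$ with $x+ae_i,\,y+ae_i\in[0,1]^n$, one has $F(x+ae_i)-F(x)\ge F(y+ae_i)-F(y)$; for differentiable $F$ this is equivalent to $\nabla F(x)\ge\nabla F(y)$ whenever $x\le y$. The algorithm has access to oracles computing $F(x)$, $\nabla F(x)$, and a maximizer of a linear function over $P$. Harmonic numbers: $H_0=0$, $H_j=\sum_{k=1}^j 1/k$. Algorithm FW-Dis$(F,P,T)$: set $x(t_0)=\mathbf{0}$. For $j=0,1,\dots,T$ define $t_j=\frac{1}{1-\ln\left(1+H_j/H_T\right)}-1$ (so $t_0=0$ and $e^{t_j/(1+t_j)}=1+H_j/H_T$). For $j=0,1,\dots,T-1$: choose $v(x(t_j))\in\arg\max_{v\in P}\langle\nabla F(x(t_j)),v\rangle$ and set \[ x(t_{j+1})=e^{-\frac{1}{1+t_j}+\frac{1}{1+t_{j+1}}}\,x(t_j)+\Bigl(1-e^{-\frac{1}{1+t_j}+\frac{1}{1+t_{j+1}}}\Bigr)v(x(t_j)). \] (The algorithm returns a point of maximum $F$-value among the iterates $x(t_j)$.) *)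

(* Defs.v *)
From HB Require Import structures.
From mathcomp Require Import all_boot all_order all_algebra.
From mathcomp Require Import all_classical all_reals all_analysis.

Set Implicit Arguments.
Unset Strict Implicit.
Unset Printing Implicit Defensive.

Import Order.TTheory GRing.Theory Num.Theory.
Import numFieldNormedType.Exports.

Local Open Scope classical_set_scope.
Local Open Scope ring_scope.

Section FrankWolfe.
Variables (R : realType) (n : nat).
Implicit Types (x y v g : 'rV[R]_n) (P : set 'rV[R]_n) (F : 'rV[R]_n -> R)
  (gradF : 'rV[R]_n -> 'rV[R]_n) (L : R) (T j : nat).

Definition cube : set 'rV[R]_n := [set x | forall i, 0 <= x 0 i <= 1].

Definition dotv x y : R := \sum_i x 0 i * y 0 i.

(* The library norm `|x| on 'rV[R]_n is the sup norm, hence this definition. *)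
Definition norm2 x : R := Num.sqrt (dotv x x).

Definition DR_submodular F : Prop :=
  forall x y, (forall i, x 0 i <= y 0 i) ->
  forall (i : 'I_n) (a : R), 0 < a ->
    cube x -> cube y ->
    cube (x + a *: delta_mx 0 i) -> cube (y + a *: delta_mx 0 i) ->
    F (x + a *: delta_mx 0 i) - F x >= F (y + a *: delta_mx 0 i) - F y.

(* F is a function on the cube, so the limit is taken along points of the cube
   only; this determines g, at boundary points such as 0 as well. Values of F
   outside the cube are irrelevant. *)
Definition is_gradient F x g : Prop :=
  (F y - F x - dotv g (y - x)) / norm2 (y - x) @[y --> within cube x^'] --> 0.

Definition gradient_on_cube F gradF : Prop :=
  forall x, cube x -> is_gradient F x (gradF x).

Definition smooth_on P gradF L : Prop :=
  forall x y, P x -> P y ->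
    norm2 (gradF x - gradF y) <= L * norm2 (x - y).

Definition is_argmax P (f : 'rV[R]_n -> R) x : Prop :=
  P x /\ forall y, P y -> f y <= f x.

Definition harmonic_number j : R := \sum_(1 <= k < j.+1) k%:R^-1.

Definition fw_time T j : R := (1 - ln (1 + harmonic_number j / harmonic_number T))^-1 - 1.

Definition fw_decay T j : R :=
  expR (- (1 + fw_time T j)^-1 + (1 + fw_time T j.+1)^-1).

(* x j is the iterate x(t_j); the linear oracle may return any maximizer. *)
Definition FW_Dis_run gradF P T (x : nat -> 'rV[R]_n) : Prop :=
  x 0%N = 0 /\
  forall j, (j < T)%N ->
    exists2 v, is_argmax P (dotv (gradF (x j))) v &
      x j.+1 = fw_decay T j *: x j + (1 - fw_decay T j) *: v.

End FrankWolfe.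

(* Main.v *)
Require Import Defs.
From HB Require Import structures.
From mathcomp Require Import all_boot all_order all_algebra.
From mathcomp Require Import all_classical all_reals all_analysis.
From mathcomp Require Import ring lra.

Set Implicit Arguments.
Unset Strict Implicit.
Unset Printing Implicit Defensive.

Import Order.TTheory GRing.Theory Num.Theory.
Import numFieldNormedType.Exports.

Local Open Scope classical_set_scope.
Local Open Scope ring_scope.

(* Put a_j = 1 + H_j / H_T, so that a_0 = 1, a_T = 2 and the decay factor of
   step j is a_j / a_{j+1}. Since each v lies in the cube, the coordinates of x_j
   stay below 1 - 1/a_j, so concavity of F along nonnegative directions gives
   F(x_j \/ x* ) >= F(x* ) / a_j. Together with the gradient inequality
   <grad F(x), y - x> >= F(x \/ y) + F(x /\ y) - 2 F(x), the Frank-Wolfe gap at x_j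
   is at least max(0, F(x* ) / a_j - 2 F(x_j)). Hence
   a_j^2 F(x_j) >= (a_j - 1) F(x* ) - n L sum_{i<j} (a_{i+1} - a_i)^2
   by induction, and at j = T the sum is at most 2 / H_T^2 <= 2 / ln^2 T. *)

(** * Euclidean inner product and norm *)

Lemma dotvDr (R : realType) n (g x y : 'rV[R]_n) :
  dotv g (x + y) = dotv g x + dotv g y.
Proof. by rewrite /dotv -big_split; apply: eq_bigr => i _; rewrite mxE mulrDr. Qed.

Lemma dotvZr (R : realType) n (g x : 'rV[R]_n) a : dotv g (a *: x) = a * dotv g x.
Proof. by rewrite /dotv mulr_sumr; apply: eq_bigr => i _; rewrite mxE mulrCA. Qed.

Lemma dotvC (R : realType) n (x y : 'rV[R]_n) : dotv x y = dotv y x.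
Proof. by apply: eq_bigr => i _; rewrite mulrC. Qed.

Lemma dotv0r (R : realType) n (g : 'rV[R]_n) : dotv g 0 = 0.
Proof. by rewrite -(scale0r 0) dotvZr mul0r. Qed.

Lemma dotvNr (R : realType) n (g x : 'rV[R]_n) : dotv g (- x) = - dotv g x.
Proof. by rewrite -scaleN1r dotvZr mulN1r. Qed.

Lemma dotvBr (R : realType) n (g x y : 'rV[R]_n) :
  dotv g (x - y) = dotv g x - dotv g y.
Proof. by rewrite dotvDr dotvNr. Qed.

Lemma dotvBl (R : realType) n (g h x : 'rV[R]_n) :
  dotv (g - h) x = dotv g x - dotv h x.
Proof. by rewrite dotvC dotvBr !(dotvC x). Qed.

Lemma dotv_ge0 (R : realType) n (x : 'rV[R]_n) : 0 <= dotv x x.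
Proof. by apply: sumr_ge0 => i _; rewrite -expr2 sqr_ge0. Qed.

Lemma dotv_eq0 (R : realType) n (x : 'rV[R]_n) : (dotv x x == 0) = (x == 0).
Proof.
apply/idP/eqP => [|->]; last by rewrite dotv0r.
rewrite psumr_eq0 => [/allP x0|i _]; last by rewrite -expr2 sqr_ge0.
apply/rowP => i; rewrite mxE.
by have := x0 i (mem_index_enum i); rewrite /= -expr2 sqrf_eq0 => /eqP.
Qed.

Lemma norm2_ge0 (R : realType) n (x : 'rV[R]_n) : 0 <= norm2 x.
Proof. exact: sqrtr_ge0. Qed.

Lemma norm2_gt0 (R : realType) n (x : 'rV[R]_n) : (0 < norm2 x) = (x != 0).
Proof. by rewrite sqrtr_gt0 lt_neqAle dotv_ge0 andbT eq_sym dotv_eq0. Qed.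

Lemma sqr_norm2 (R : realType) n (x : 'rV[R]_n) : norm2 x ^+ 2 = dotv x x.
Proof. by rewrite sqr_sqrtr // dotv_ge0. Qed.

Lemma norm2Z (R : realType) n (x : 'rV[R]_n) a : norm2 (a *: x) = `|a| * norm2 x.
Proof.
rewrite /norm2 dotvZr dotvC dotvZr mulrA -expr2 sqrtrM ?sqr_ge0 //.
by rewrite sqrtr_sqr.
Qed.

Lemma dotv_CauchySchwarz (R : realType) n (x y : 'rV[R]_n) :
  `|dotv x y| <= norm2 x * norm2 y.
Proof.
have [->|y0] := eqVneq y 0.
  by rewrite dotv0r normr0 mulr_ge0 ?norm2_ge0.
rewrite -(ler_pXn2r (n := 2)) ?nnegrE ?mulr_ge0 ?norm2_ge0 //.
rewrite exprMn !sqr_norm2 real_normK ?num_real //.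
have yy0 : 0 < dotv y y by rewrite -sqr_norm2 exprn_gt0 // norm2_gt0.
(* This vector is [dotv y y] times the component of [x] orthogonal to [y]; its squared length
   expands to [c * (a * c - b ^+ 2)]. *)
have := dotv_ge0 (dotv y y *: x - dotv x y *: y).
rewrite dotvBr !dotvZr !dotvBl ![dotv (_ *: _) _]dotvC !dotvZr (dotvC y x).
set a := dotv x x; set b := dotv x y; set c := dotv y y => h.
have : 0 <= c * (a * c - b ^+ 2) by move: h; congr (0 <= _); ring.
by rewrite pmulr_rge0 // subr_ge0.
Qed.

(** * DR-submodularity along segments of the cube *)

Lemma cube_between (R : realType) n (x y z : 'rV[R]_n) : cube x -> cube z ->
  (forall i, x 0 i <= y 0 i) -> (forall i, y 0 i <= z 0 i) -> cube y.
Proof.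
move=> cx cz xy yz i; have /andP[x0 _] := cx i; have /andP[_ z1] := cz i.
by rewrite (le_trans x0 (xy i)) (le_trans (yz i) z1).
Qed.

Lemma cube_segment (R : realType) n (x d : 'rV[R]_n) (s : R) :
  cube x -> cube (x + d) -> 0 <= s <= 1 -> cube (x + s *: d).
Proof.
move=> cx cd /andP[s0 s1] i; have := cx i; have := cd i; rewrite !mxE.
move=> /andP[h1 h2] /andP[h3 h4]; apply/andP; split; nra.
Qed.

(** A division-free form of the limit, which also covers [s = 0]. The radius is divided by the sup
    norm of [d], which defines the neighbourhoods, and the error by its Euclidean norm, which stands
    in [is_gradient]. *)
Lemma gradient_line (R : realType) n (F : 'rV[R]_n -> R) (x g d : 'rV[R]_n) :
  is_gradient F x g -> forall e : R, 0 < e -> exists2 r : R, 0 < r &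
  forall s, `|s| < r -> cube (x + s *: d) ->
    `|F (x + s *: d) - F x - s * dotv g d| <= e * `|s|.
Proof.
move=> dF e e0; have [->|d0] := eqVneq d 0.
  exists 1 => // s _ _.
  rewrite scaler0 addr0 subrr dotv0r mulr0 subrr normr0.
  by rewrite mulr_ge0 // ltW.
have Nd0 : 0 < norm2 d by rewrite norm2_gt0.
have nd0 : 0 < `|d| by rewrite normr_gt0.
move/cvgrPdist_lt: dF => /(_ (e / norm2 d) (divr_gt0 e0 Nd0)).
rewrite near_withinE near_withinE => /nbhs_normP [r0 /= r00 rP].
exists (r0 / `|d|); first exact: divr_gt0.
move=> s sr csd; have [->|s0] := eqVneq s 0.
  by rewrite scale0r addr0 mul0r subr0 subrr normr0 mulr0.
have := rP (x + s *: d).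
rewrite /= opprD addrA subrr add0r normrN normrZ -ltr_pdivlMr // => /(_ sr).
have -> : x + s *: d != x.
  by rewrite -subr_eq0 addrAC subrr add0r scaler_eq0 negb_or s0.
move=> /(_ isT csd).
have -> : x + s *: d - x = s *: d by rewrite addrAC subrr add0r.
rewrite norm2Z dotvZr sub0r normrN normrM normfV.
rewrite [`|(_ * norm2 d)|]ger0_norm ?mulr_ge0 ?norm2_ge0 //.
rewrite ltr_pdivrMr ?mulr_gt0 ?normr_gt0 // => /ltW /le_trans; apply.
by rewrite mulrCA divfK ?gt_eqF // mulrC.
Qed.

Lemma DR_submodular_increment (R : realType) n (F : 'rV[R]_n -> R)
    (x y d : 'rV[R]_n) : DR_submodular F ->
  (forall i, x 0 i <= y 0 i) -> (forall i, 0 <= d 0 i) ->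
  cube x -> cube (y + d) ->
  F (y + d) - F y <= F (x + d) - F x.
Proof.
move=> DR xy d0 cx cyd.
(* [d] is added one coordinate at a time: [p k] keeps its first [k] coordinates, so passing from
   [p k] to [p k.+1] is a move along one axis. *)
pose p k : 'rV[R]_n := \row_i (if (i < k)%N then d 0 i else 0).
have p0 k i : 0 <= p k 0 i by rewrite mxE; case: ifP.
have pd k i : p k 0 i <= d 0 i by rewrite mxE; case: ifP.
suff H k : (k <= n)%N -> F (y + p k) - F y <= F (x + p k) - F x.
  have -> : d = p n by apply/rowP => i; rewrite mxE ltn_ord.
  exact: H.
elim: k => [_|k IH kn].
  have -> : p 0%N = 0 by apply/rowP => i; rewrite !mxE.
  by rewrite !addr0 !subrr.
apply: (@le_trans _ _ ((F (y + p k.+1) - F (y + p k)) + (F (x + p k) - F x))).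
  by rewrite -(subrKA (F (y + p k))) lerD2l IH // ltnW.
rewrite -[leRHS](subrKA (F (x + p k))) lerD2r.
pose i := Ordinal kn.
have pS : p k.+1 = p k + d 0 i *: delta_mx 0 i.
  apply/rowP => j; rewrite !mxE /= ltnS leq_eqVlt.
  have [->|ji] := eqVneq j i; first by rewrite /= eqxx ltnn add0r mulr1.
  have /negPf -> : (j : nat) != k by [].
  by rewrite mulr0 addr0.
(* [DR_submodular] asks for a positive step, so a zero coordinate is settled apart. *)
have := d0 i; rewrite le_eqVlt => /predU1P[di|di].
  by rewrite pS -di scale0r addr0 !subrr.
have px k' j : x 0 j <= (x + p k') 0 j by rewrite mxE lerDl.
have py k' j : (y + p k') 0 j <= (y + d) 0 j by rewrite [leLHS]mxE [leRHS]mxE lerD2l.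
have pxy k' j : (x + p k') 0 j <= (y + p k') 0 j by rewrite [leLHS]mxE [leRHS]mxE lerD2r.
have cpx k' : cube (x + p k').
  by apply: (cube_between cx cyd) => // j; apply: le_trans (pxy k' j) (py k' j).
have cpy k' : cube (y + p k').
  by apply: (cube_between cx cyd) => // j; apply: le_trans (px k' j) (pxy k' j).
by rewrite pS !addrA; apply: DR; rewrite -?addrA -?pS.
Qed.

(** The directions along which DR-submodularity gives concavity. Both signs occur, since a general
    difference splits into a nonnegative and a nonpositive part. *)
Definition same_sign (R : realType) n (d : 'rV[R]_n) : Prop :=
  (forall i, 0 <= d 0 i) \/ (forall i, d 0 i <= 0).

Lemma line_increment (R : realType) n (F : 'rV[R]_n -> R) (x d : 'rV[R]_n)
    (u s : R) : DR_submodular F -> same_sign d -> cube x -> cube (x + d) ->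
  0 <= u -> 0 <= s -> u + s <= 1 ->
  F (x + (u + s) *: d) - F (x + u *: d) <= F (x + s *: d) - F x.
Proof.
move=> DR [d0|d0] cx cxd u0 s0 us1.
  rewrite scalerDl addrA; apply: DR_submodular_increment => //.
  - by move=> i; rewrite !mxE lerDl mulr_ge0.
  - by move=> i; rewrite !mxE mulr_ge0.
  - by rewrite -addrA -scalerDl; apply: cube_segment => //; lra.
(* For [d <= 0] the move is reversed: adding [- (s *: d)] is a nonnegative step, and
   [x + (u + s) *: d] is now the smaller base point. Both increments change sign. *)
have := @DR_submodular_increment _ _ F (x + (u + s) *: d) (x + s *: d)
  (- (s *: d)) DR.
rewrite addrK scalerDl addrA addrK => H.
rewrite -lerN2 !opprB; apply: H => //.
- by move=> i; rewrite !mxE; have := d0 i; nra.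
- by move=> i; rewrite !mxE; have := d0 i; nra.
- by rewrite -addrA -scalerDl; apply: cube_segment => //; lra.
Qed.

(* Cutting the segment into k equal pieces, DR-submodularity makes the first
   increment the largest one, and k times it tends to the slope at x. *)
Lemma gradient_tangent (R : realType) n (F : 'rV[R]_n -> R) (x g d : 'rV[R]_n) :
  DR_submodular F -> is_gradient F x g -> same_sign d ->
  cube x -> cube (x + d) -> F (x + d) - F x <= dotv g d.
Proof.
move=> DR dF dd cx cxd; rewrite leNgt; apply/negP => lt.
(* Half of the supposed excess: [k] times the slope estimate bounds the whole increment by
   [dotv g d + e], which is too small by [e]. *)
pose e := (F (x + d) - F x - dotv g d) / 2.
have e0 : 0 < e by rewrite divr_gt0 // subr_gt0.
have [r r0 rP] := gradient_line d dF e0.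
pose k := (Num.truncn r^-1).+1.
pose s : R := k%:R^-1.
have k0 : 0 < k%:R :> R by rewrite ltr0n.
have s0 : 0 < s by rewrite invr_gt0.
have ks : k%:R * s = 1 by rewrite divff // gt_eqF.
have sr : `|s| < r.
  rewrite gtr0_norm // -[ltRHS]invrK ltf_pV2 ?posrE ?invr_gt0 //.
  by have /andP[] := truncn_itv (ltW (etrans (invr_gt0 r) r0)).
have s1 : s <= 1 by rewrite invf_le1 // ler1n.
have s01 : 0 <= s <= 1 by rewrite (ltW s0).
have := rP s sr (cube_segment cx cxd s01); rewrite (gtr0_norm s0) => /ler_normlW slope.
have tel m : (m <= k)%N ->
    F (x + (m%:R * s) *: d) - F x <= m%:R * (F (x + s *: d) - F x).
  elim: m => [_|m IH mk]; first by rewrite !mul0r scale0r addr0 subrr.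
  have := @line_increment _ _ F x d (m%:R * s) s DR dd cx cxd.
  rewrite !mulr_ge0 ?(ltW s0) //.
  have -> : m%:R * s + s <= 1.
    have mk' : m%:R + 1 <= k%:R :> R by rewrite natr1 ler_nat.
    by have := ler_wpM2r (ltW s0) mk'; rewrite ks mulrDl mul1r.
  move=> /(_ isT isT isT) h; have := IH (ltnW mk).
  rewrite -natr1 !mulrDl !mul1r; lra.
have := tel k (leqnn _); rewrite ks scale1r => tk.
have : k%:R * (F (x + s *: d) - F x) <= k%:R * (s * dotv g d + e * s).
  by rewrite ler_pM2l //; lra.
have -> : k%:R * (s * dotv g d + e * s) = (k%:R * s) * (dotv g d + e) by ring.
rewrite ks mul1r; rewrite /e in tk *; lra.
Qed.

(** * Coordinatewise maxima and the Frank-Wolfe gap *)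

Definition joinv (R : realType) n (x y : 'rV[R]_n) : 'rV[R]_n :=
  \row_i Num.max (x 0 i) (y 0 i).

Lemma cube_joinv (R : realType) n (x y : 'rV[R]_n) :
  cube x -> cube y -> cube (joinv x y).
Proof. 
move=> cx cy i; rewrite mxE.
by case: (leP (x 0 i) (y 0 i)) => _; [apply: cy | apply: cx].
 Qed.

(** Moving by the positive part of [y - x] reaches the join, and by the negative part the meet. The
    tangent inequality holds for each part; their sum is the claim once the value at the meet is
    bounded below by 0. *)
Lemma gradient_gap_joinv (R : realType) n (F : 'rV[R]_n -> R)
    (x y g : 'rV[R]_n) : (forall z, cube z -> 0 <= F z) ->
  DR_submodular F -> is_gradient F x g -> cube x -> cube y ->
  F (joinv x y) - 2 * F x <= dotv g (y - x).
Proof.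
move=> F0 DR dF cx cy.
pose u : 'rV[R]_n := \row_i Num.max (y 0 i - x 0 i) 0.
pose w : 'rV[R]_n := \row_i Num.min (y 0 i - x 0 i) 0.
have -> : y - x = u + w by apply/rowP => i; rewrite !mxE addr_max_min addr0.
have Eu : x + u = joinv x y.
  by apply/rowP => i; rewrite !mxE addr_maxr addrC subrK addr0 maxC.
have cu : cube (x + u) by rewrite Eu; apply: cube_joinv.
have cw : cube (x + w).
  move=> i; rewrite !mxE; have := cx i; have := cy i; case: (leP (y 0 i - x 0 i) 0) => h; lra.
have hu := gradient_tangent DR dF _ cx cu.
have hw := gradient_tangent DR dF _ cx cw.
have {hu} := hu (or_introl _); have {hw} := hw (or_intror _).
have pw i : w 0 i <= 0 by rewrite mxE ge_min lexx orbT.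
have pu i : 0 <= u 0 i by rewrite mxE le_max lexx orbT.
move=> /(_ pw) hw /(_ pu) hu; rewrite dotvDr -Eu.
by have := F0 _ cw; lra.
Qed.

(** The segment from [y] to the join can be prolonged by the factor [1 / t] inside the cube.
    Concavity along it, with [F >= 0] at the far end, leaves the share [1 - t] of [F y]. *)
Lemma DR_submodular_joinv (R : realType) n (F : 'rV[R]_n -> R) gradF
    (x y : 'rV[R]_n) (t : R) : (forall z, cube z -> 0 <= F z) ->
  gradient_on_cube F gradF -> DR_submodular F -> cube x -> cube y ->
  0 <= t <= 1 -> (forall i, x 0 i <= t) ->
  (1 - t) * F y <= F (joinv x y).
Proof.
move=> F0 dF DR cx cy /andP[t0 t1] xt.
pose e : 'rV[R]_n := \row_i Num.max (x 0 i - y 0 i) 0.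
have e0 i : 0 <= e 0 i by rewrite mxE le_max lexx orbT.
have et i : e 0 i <= t * (1 - y 0 i).
  by rewrite mxE ge_max; have /andP[] := cy i; have := xt i => *; apply/andP; split; nra.
have Ez : joinv x y = y + e.
  by apply/rowP => i; rewrite !mxE addr_maxr addrC subrK addr0.
clearbody e; have cz : cube (y + e) by rewrite -Ez; apply: cube_joinv.
rewrite Ez; have [t00|tn0] := eqVneq t 0.
  have -> : e = 0.
    apply/rowP => i; rewrite [RHS]mxE; apply/le_anti.
    by rewrite e0 andbT (le_trans (et i)) // t00 mul0r.
  by rewrite addr0 t00 subr0 mul1r.
have tp : 0 < t by rewrite lt_neqAle eq_sym tn0.
have tV : t * t^-1 = 1 by rewrite divff.
have tV1 : 1 <= t^-1 by rewrite invf_ge1.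
(* The far end is [y + t^-1 *: e]; it stays in the cube because [e <= t * (1 - y)] in each
   coordinate. *)
have cw : cube (y + e + (t^-1 - 1) *: e).
  move=> i; have /andP[y0 y1] := cy i; have := e0 i; have := et i.
  rewrite !mxE; set z := e 0 i => h1 h2.
  have h3 : t^-1 * z <= 1 - y 0 i by rewrite mulrC ler_pdivrMr // mulrC.
  by apply/andP; split; nra.
have cm : cube (y + e + - e) by rewrite addrK.
have up : same_sign ((t^-1 - 1) *: e).
  by left => i; rewrite mxE mulr_ge0 // subr_ge0.
have dn : same_sign (- e) by right => i; rewrite mxE oppr_le0.
have h1 := gradient_tangent DR (dF _ cz) up cz cw.
have h2 := gradient_tangent DR (dF _ cz) dn cz cm.
have h3 := F0 _ cw; move: h1 h2; rewrite addrK dotvZr dotvNr => h1 h2.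
set G := dotv _ _ in h1 h2; set Fw := F (_ + _ *: _) in h1 h3.
(* With weights [t] and [1 - t] the two tangent inequalities at the join have opposite gradient
   terms, which cancel. *)
have : t * (Fw - F (y + e)) <= t * ((t^-1 - 1) * G) by rewrite ler_pM2l.
have -> : t * ((t^-1 - 1) * G) = (t * t^-1 - t) * G by ring.
have : (1 - t) * (F y - F (y + e)) <= (1 - t) * - G by rewrite ler_wpM2l // subr_ge0.
have : 0 <= t * Fw by rewrite mulr_ge0.
rewrite tV; lra.
Qed.

(** * Lower bound for a step, from smoothness *)

Lemma is_derive1_dist (R : realType) (f : R -> R) (t D : R) :
  (forall e : R, 0 < e -> exists2 r : R, 0 < r &
    forall h, `|h| < r -> `|f (t + h) - f t - h * D| <= e * `|h|) ->
  is_derive t 1 f D.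
Proof.
move=> H.
have C : h^-1 *: ((f \o shift t) (h *: 1) - f t) @[h --> 0^'] --> D.
  apply/cvgrPdist_le => e e0; have [r r0 rP] := H e e0.
  rewrite near_withinE; apply/nbhs_normP; exists r => // h /=.
  rewrite sub0r normrN => hr h0; have := rP h hr.
  rewrite -ler_pdivrMr ?normr_gt0 // -normfV -normrM distrC; congr (_ <= _).
  congr `|_|; rewrite /= /GRing.scale /= mulr1 (addrC h).
  by field.
apply: DeriveDef; first by apply/cvg_ex; exists D.
exact: cvg_lim.
Qed.

Lemma convex_set_segment (R : realType) n (P : set 'rV[R]_n) (x d : 'rV[R]_n)
    (s : R) : convex_set P -> P x -> P (x + d) -> 0 <= s <= 1 ->
  P (x + s *: d).
Proof.
move=> cP Px Pd s01.
have := cP (x + d) x (Itv01 (proj1 (andP s01)) (proj2 (andP s01))).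
rewrite !inE => /(_ Pd Px).
suff -> : x + s *: d = s *: (x + d) + (1 - s) *: x by [].
by apply/rowP => i; rewrite !mxE; ring.
Qed.

(** The mean value theorem on the segment gives the slope at one inner point [c]; smoothness and
    Cauchy-Schwarz compare it with the slope at [x]. This yields the constant [L] instead of the
    [L / 2] of an integral argument. *)
Lemma smooth_descent (R : realType) n (P : set 'rV[R]_n) (F : 'rV[R]_n -> R)
    gradF (L : R) (x d : 'rV[R]_n) : P `<=` @cube R n -> convex_set P ->
  gradient_on_cube F gradF -> 0 <= L -> smooth_on P gradF L ->
  P x -> P (x + d) ->
  F x + dotv (gradF x) d - L * dotv d d <= F (x + d).
Proof.
move=> Pc cP dF L0 sm Px Pd; have cx := Pc _ Px; have cd := Pc _ Pd.
pose f t := F (x + t *: d); pose df t := dotv (gradF (x + t *: d)) d.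
(* The restriction [0 <= t + h <= 1] makes the estimate one-sided at 0 and 1, so it serves for the
   inner derivative and for continuity up to the ends. *)
have line (t : R) : 0 <= t <= 1 -> forall e : R, 0 < e -> exists2 r : R, 0 < r &
    forall h, `|h| < r -> 0 <= t + h <= 1 ->
      `|f (t + h) - f t - h * df t| <= e * `|h|.
  move=> t01 e e0.
  have [r r0 rP] := gradient_line d (dF _ (cube_segment cx cd t01)) e0.
  exists r => // h hr th; have := rP h hr.
  by rewrite -addrA -scalerDl; apply; apply: cube_segment.
have [t||c] := @MVT R f df 0 1 ltr01.
- rewrite in_itv /= => /andP[t0 t1]; apply: is_derive1_dist => e e0.
  have [|r r0 rP] := line t _ e e0; first by rewrite !ltW.
  exists (Num.min r (Num.min t (1 - t))); first by rewrite !lt_min r0 t0 subr_gt0.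
  move=> h; rewrite !lt_min => /and3P[hr /ltr_normlP[h1 h2] /ltr_normlP[h3 h4]].
  by apply: rP => //; lra.
- apply/subspace_continuousP => t /=; rewrite in_itv /= => t01.
  apply/cvgrPdist_le => e e0; have [r r0 rP] := line t t01 1 ltr01.
  (* The estimate with error coefficient 1 makes [M] a local Lipschitz constant of [f] at [t]. *)
  pose M := `|df t| + 1.
  have M0 : 0 < M by rewrite ltr_wpDl.
  rewrite near_withinE; apply/nbhs_normP; exists (Num.min r (e / M)).
    by rewrite /= lt_min r0 divr_gt0.
  move=> s /=; rewrite lt_min => /andP[sr se]; rewrite in_itv /= => s01.
  have h : `|f s - f t - (s - t) * df t| <= `|s - t|.
    have := rP (s - t); rewrite mul1r [t + _]addrC subrK; apply => //.
    by rewrite distrC.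
  rewrite distrC.
  have -> : f s - f t = (f s - f t - (s - t) * df t) + (s - t) * df t by rewrite subrK.
  apply: le_trans (ler_normD _ _) _; rewrite normrM.
  move: se; rewrite ltr_pdivlMr // /M distrC => se; lra.
- rewrite in_itv /= => /andP[c0 c1]; rewrite /f scale1r scale0r addr0 subr0 mulr1.
  move=> E; have c01 : 0 <= c <= 1 by rewrite !ltW.
  have /= CS := dotv_CauchySchwarz (gradF (x + c *: d) - gradF x) d.
  have := sm _ _ (convex_set_segment cP Px Pd c01) Px.
  have -> : x + c *: d - x = c *: d by rewrite addrAC subrr add0r.
  rewrite norm2Z (gtr0_norm c0) => S.
  have : norm2 (gradF (x + c *: d) - gradF x) * norm2 d <= L * dotv d d.
    rewrite -sqr_norm2 expr2 mulrA ler_wpM2r ?norm2_ge0 //.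
    apply: le_trans S _; rewrite ler_wpM2l // ler_piMl ?norm2_ge0 // ltW //.
  move=> /(le_trans CS) /ler_normlP[]; rewrite dotvBl -/(df c).
  move: E; rewrite /df; lra.
Qed.

(** * Harmonic numbers, step weights and the scalar potential inequality *)

Lemma harmonic_numberS (R : realType) j :
  harmonic_number R j.+1 = harmonic_number R j + j.+1%:R^-1.
Proof. by rewrite /harmonic_number big_nat_recr. Qed.

Lemma harmonic_number_ge0 (R : realType) j : 0 <= harmonic_number R j.
Proof. by apply: sumr_ge0 => k _; rewrite invr_ge0. Qed.

Lemma harmonic_number_gt0 (R : realType) j : (0 < j)%N -> 0 < harmonic_number R j.
Proof.
case: j => // j _.
by rewrite harmonic_numberS ltr_wpDl ?harmonic_number_ge0 // invr_gt0.
Qed.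

Lemma ln_le_harmonic_number (R : realType) j : ln j.+1%:R <= harmonic_number R j.
Proof.
elim: j => [|j IH]; first by rewrite ln1 harmonic_number_ge0.
have j0 : 0 < j.+1%:R :> R by rewrite ltr0n.
have -> : j.+2%:R = j.+1%:R * (1 + j.+1%:R^-1) :> R.
  by rewrite mulrDr mulr1 divff ?gt_eqF // natr1.
have i0 : 0 < j.+1%:R^-1 :> R by rewrite invr_gt0.
rewrite lnM ?posrE ?addr_gt0 // harmonic_numberS lerD // le_ln1Dx //.
by rewrite (lt_trans _ i0) // ltrN10.
Qed.

Lemma sum_inv_sqr_le2 (R : realType) j : \sum_(i < j) (i.+1%:R^-1) ^+ 2 <= 2 :> R.
Proof.
case: j => [|j]; first by rewrite big_ord0.
(* The bound is strengthened so that induction goes through: each new square is at most the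
   telescoping term [1 / (c * (c + 1))]. *)
suff : \sum_(i < j.+1) (i.+1%:R^-1) ^+ 2 <= 2 - j.+1%:R^-1 :> R.
  by move=> /le_trans; apply; rewrite gerBl invr_ge0.
elim: j => [|j IH]; first by rewrite big_ord1 invr1 expr1n; lra.
rewrite big_ord_recr /= (le_trans (lerD IH (lexx _))) //.
have j0 : 0 < j.+1%:R :> R by rewrite ltr0n.
rewrite -[j.+2%:R]natr1; set c := j.+1%:R in j0 *.
have c1 : 0 < c + 1 by rewrite addr_gt0.
have -> : c^-1 = (c + 1)^-1 + (c * (c + 1))^-1.
  by field; rewrite !gt_eqF.
have : ((c + 1)^-1) ^+ 2 <= (c * (c + 1))^-1.
  rewrite exprVn lef_pV2 ?posrE ?exprn_gt0 ?mulr_gt0 // expr2 ler_pM2r //.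
  by rewrite lerDl.
move: ((c + 1)^-1 ^+ 2) (c + 1)^-1 (c * (c + 1))^-1 => p q r; lra.
Qed.

Definition fw_weight (R : realType) T j : R :=
  1 + harmonic_number R j / harmonic_number R T.

Lemma fw_weight_ge1 (R : realType) T j : 1 <= fw_weight R T j.
Proof. by rewrite lerDl divr_ge0 ?harmonic_number_ge0. Qed.

Lemma fw_weight_gt0 (R : realType) T j : 0 < fw_weight R T j.
Proof. exact: lt_le_trans ltr01 (fw_weight_ge1 _ _ _). Qed.

Lemma fw_weightS (R : realType) T j :
  fw_weight R T j.+1 = fw_weight R T j + (j.+1%:R * harmonic_number R T)^-1.
Proof. by rewrite /fw_weight harmonic_numberS mulrDl addrA invfM. Qed.

(** The times are chosen so that [(1 + t_j)^-1 = 1 - ln a_j]; the exponent is thus a difference of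
    logarithms of weights. *)
Lemma fw_decayE (R : realType) T j :
  fw_decay R T j = fw_weight R T j / fw_weight R T j.+1.
Proof.
rewrite /fw_decay /fw_time ![1 + (_^-1 - 1)]addrC !subrK !invrK.
rewrite -!/(fw_weight _ _ _) opprB addrA subrK expRD expRN !lnK ?posrE //;
  exact: fw_weight_gt0.
Qed.

(* With G the Frank-Wolfe gap, the discretisation error of the potential
   a^2 f - (a - 1) Fs is d^2 (Fs / a - f) up to the smoothness term. When it is
   negative, f > Fs / a and G >= 0 alone suffices. *)
Lemma potential_step (R : realType) (a d f f' Fs G E c : R) :
  1 <= a -> 0 < d -> 0 <= Fs -> 0 <= E -> 0 <= G -> Fs / a - 2 * f <= G ->
  f + d / (a + d) * G - c * (d / (a + d)) ^+ 2 <= f' ->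
  (a - 1) * Fs - E <= a ^+ 2 * f ->
  (a + d - 1) * Fs - (E + c * d ^+ 2) <= (a + d) ^+ 2 * f'.
Proof.
move=> a1 d0 Fs0 E0 G0 hG hf' hf.
have a0 : 0 < a by lra.
have b0 : 0 < a + d by lra.
set q := Fs / a in hG.
have Eq : Fs = a * q by rewrite /q mulrC divfK // gt_eqF.
have q0 : 0 <= q by rewrite divr_ge0 // ltW.
have : (a + d) ^+ 2 * (f + d / (a + d) * G - c * (d / (a + d)) ^+ 2)
    <= (a + d) ^+ 2 * f' by rewrite ler_wpM2l // sqr_ge0.
have -> : (a + d) ^+ 2 * (f + d / (a + d) * G - c * (d / (a + d)) ^+ 2) =
    (a + d) ^+ 2 * f + (a + d) * d * G - c * d ^+ 2.
  by field; rewrite gt_eqF.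
apply: le_trans; rewrite opprD addrA lerD2r Eq in hf *.
have bd0 : 0 < (a + d) * d by rewrite mulr_gt0.
case: (leP f q) => fq.
  have := ler_wpM2l (ltW bd0) hG.
  have : 0 <= d ^+ 2 * (q - f) by rewrite mulr_ge0 ?sqr_ge0 // subr_ge0.
  rewrite -subr_ge0 => h1; rewrite -subr_ge0 => h2; nra.
have : 0 <= (a + d) * d * G by rewrite mulr_ge0 // ltW.
have : (a + d) ^+ 2 * q <= (a + d) ^+ 2 * f by rewrite ler_wpM2l ?sqr_ge0 // ltW.
have : 0 <= (a + d) * d * q by rewrite mulr_ge0 // ltW.
have : 0 <= a * q by rewrite mulr_ge0 // ltW.
lra.
Qed.

(** * The invariant along a run and the final bounds *)

Lemma dotv_cube_diff (R : realType) n (x y : 'rV[R]_n) :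
  cube x -> cube y -> dotv (x - y) (x - y) <= n%:R.
Proof.
move=> cx cy; apply: (@le_trans _ _ (\sum_(i < n) 1)).
  by apply: ler_sum => i _; rewrite !mxE; have := cx i; have := cy i; nra.
by rewrite sumr_const card_ord.
Qed.

(** The three claims are carried together: membership in [P] gives access to smoothness and to the
    oracle, and the coordinate bound feeds [DR_submodular_joinv] in the potential step. *)
Lemma FW_Dis_invariant (R : realType) n (P : set 'rV[R]_n) (F : 'rV[R]_n -> R)
    gradF (L : R) (xstar : 'rV[R]_n) T (x : nat -> 'rV[R]_n) :
  P `<=` @cube R n -> convex_set P -> P 0 ->
  (forall x, cube x -> 0 <= F x) -> gradient_on_cube F gradF ->
  DR_submodular F -> 0 <= L -> smooth_on P gradF L -> P xstar ->
  (0 < T)%N -> FW_Dis_run gradF P T x ->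
  forall j, (j <= T)%N ->
  [/\ P (x j), forall i, x j 0 i <= 1 - (fw_weight R T j)^-1 &
    (fw_weight R T j - 1) * F xstar
      - L * n%:R * \sum_(i < j) ((i.+1%:R * harmonic_number R T)^-1) ^+ 2
    <= fw_weight R T j ^+ 2 * F (x j)].
Proof.
move=> Pc cP P0 F0 dF DR L0 sm Ps T0 [x0 run]; elim=> [_|j IH jT].
  have w0 : fw_weight R T 0 = 1.
    by rewrite /fw_weight /harmonic_number big_geq // mul0r addr0.
  rewrite x0 w0 invr1 !subrr mul0r big_ord0 mulr0 subr0 expr1n mul1r; split => //.
    by move=> i; rewrite mxE.
  exact/F0/Pc.
have [Pj xj pot] := IH (ltnW jT); have [v [Pv vmax] xS] := run j jT.
rewrite fw_decayE in xS; rewrite big_ord_recr /= mulrDr.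
have a1 := fw_weight_ge1 R T j; have a0 := fw_weight_gt0 R T j.
have b0 := fw_weight_gt0 R T j.+1.
have d0 : 0 < (j.+1%:R * harmonic_number R T)^-1.
  by rewrite invr_gt0 mulr_gt0 ?harmonic_number_gt0.
move: xS b0; rewrite fw_weightS; set d := (_ * _)^-1 in d0 *.
set a := fw_weight R T j in a1 a0 xj pot *; set E := _ * \sum_(i < j) _ in pot *.
move=> xS b0; have gE : 1 - a / (a + d) = d / (a + d) by field; rewrite gt_eqF.
have g0 : 0 <= d / (a + d) by rewrite divr_ge0 // ltW.
have g1 : d / (a + d) <= 1 by rewrite ler_pdivrMr // mul1r lerDr ltW.
have cj := Pc _ Pj; have cv := Pc _ Pv; have cs := Pc _ Ps.
have xS' : x j.+1 = x j + (d / (a + d)) *: (v - x j).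
  by rewrite xS -gE; apply/rowP => i; rewrite !mxE; ring.
have PS : P (x j.+1).
  by rewrite xS'; apply: convex_set_segment; rewrite ?g0 // addrC subrK.
split => //.
  (* Since [v <= 1], the new coordinate is at most [a / (a + d) * (1 - 1 / a) + d / (a + d) = 1 - 1
     / (a + d)]. *)
  move=> i; rewrite xS gE !mxE; have /andP[_ v1] := cv i.
  have aV : a / (a + d) * a^-1 = (a + d)^-1 by field; rewrite !gt_eqF.
  have := ler_wpM2l (divr_ge0 (ltW a0) (ltW b0)) (xj i).
  have := ler_wpM2l g0 v1; rewrite mulrBr aV -gE; lra.
apply: (@potential_step _ _ _ (F (x j)) _ _ (dotv (gradF (x j)) (v - x j))) => //.
- exact: F0.
- by rewrite mulr_ge0 ?mulr_ge0 // sumr_ge0 // => i _; rewrite sqr_ge0.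
- by rewrite dotvBr subr_ge0 vmax.
(* The oracle's [v] does at least as well as [xstar]; the gap towards [xstar] is then bounded
   through the join, with [t = 1 - 1 / a]. *)
- apply: (@le_trans _ _ (dotv (gradF (x j)) (xstar - x j))); last first.
    by rewrite !dotvBr lerD2r vmax.
  apply: le_trans (gradient_gap_joinv F0 DR (dF _ cj) cj cs); rewrite lerD2r.
  have := @DR_submodular_joinv _ _ F gradF (x j) xstar (1 - a^-1) F0 dF DR cj cs.
  rewrite subKr mulrC; apply => //.
  by rewrite subr_ge0 invf_le1 // a1 gerBl invr_ge0 ltW.
- have := @smooth_descent _ _ P F gradF L (x j) _ Pc cP dF L0 sm Pj.
  move=> /(_ (d / (a + d) *: (v - x j))); rewrite -xS' => /(_ PS).
  apply: le_trans; rewrite dotvZr lerD2l lerN2 -mulrA ler_wpM2l //.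
  rewrite dotvZr dotvC dotvZr mulrA -expr2 mulrC ler_wpM2r ?sqr_ge0 //.
  exact: dotv_cube_diff.
Qed.

Lemma FW_Dis_bound (R : realType) n (P : set 'rV[R]_n) (F : 'rV[R]_n -> R)
    gradF (L : R) (xstar : 'rV[R]_n) T (x : nat -> 'rV[R]_n) :
  P `<=` @cube R n -> convex_set P -> P 0 ->
  (forall x, cube x -> 0 <= F x) -> gradient_on_cube F gradF ->
  DR_submodular F -> 0 <= L -> smooth_on P gradF L -> P xstar ->
  (0 < T)%N -> FW_Dis_run gradF P T x ->
  1 / 4 * F xstar - n%:R * L / harmonic_number R T ^+ 2 <= F (x T).
Proof.
move=> Pc cP P0 F0 dF DR L0 sm Ps T0 run.
have [_ _] := FW_Dis_invariant Pc cP P0 F0 dF DR L0 sm Ps T0 run (leqnn T).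
have H0 := harmonic_number_gt0 R T0.
have -> : fw_weight R T T = 2 by rewrite /fw_weight divff ?gt_eqF.
under eq_bigr do rewrite invfM exprMn.
rewrite -mulr_suml => pot.
(* Dividing by [a_T ^+ 2 = 4] turns the error [2 * L * n * h] into half of [L * n * h], which is
   rounded up. *)
set h := (harmonic_number R T)^-1 ^+ 2 in pot.
have : L * n%:R * ((\sum_(i < T) i.+1%:R^-1 ^+ 2) * h) <= L * n%:R * (2 * h).
  by rewrite ler_wpM2l ?mulr_ge0 // ler_wpM2r ?sqr_ge0 // sum_inv_sqr_le2.
have : 0 <= L * n%:R * h by rewrite mulr_ge0 ?sqr_ge0 // mulr_ge0.
by rewrite -exprVn -/h; lra.
Qed.

Theorem theorem1 (R : realType) :
  exists C1 C2 : R, 0 < C1 /\ 0 < C2 /\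
  forall (n : nat) (P : set 'rV[R]_n) (F : 'rV[R]_n -> R)
    (gradF : 'rV[R]_n -> 'rV[R]_n) (L : R) (xstar : 'rV[R]_n),
  (1 <= n)%N ->
  P `<=` @cube R n -> convex_set P -> P 0 ->
  (forall x, cube x -> 0 <= F x) ->
  gradient_on_cube F gradF ->
  DR_submodular F ->
  F 0 = 0 ->
  0 <= L -> smooth_on P gradF L ->
  is_argmax P F xstar ->
  (forall (T : nat) (x : nat -> 'rV[R]_n), (2 <= T)%N ->
     FW_Dis_run gradF P T x ->
     F (x T) >= 1 / 4 * F xstar - C1 * (n%:R * L / ln T%:R ^+ 2)) /\
  (forall eps : R, 0 < eps ->
     exists N : nat, [/\ (1 <= N)%N,
       N%:R <= C2 * expR (Num.sqrt (n%:R * L / eps)) &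
       forall (T : nat) (x : nat -> 'rV[R]_n), (N <= T)%N ->
         FW_Dis_run gradF P T x ->
         F (x T) >= 1 / 4 * F xstar - eps]).
Proof.
(* [C1 = 1] comes from [FW_Dis_bound] and [ln T <= H_T]; [C2 = 2] absorbs rounding [expR s] up to an
   integer, as [expR s >= 1]. *)
exists 1, 2; split; [by [] | split; [by [] |]].
move=> n P F gradF L xstar _ Pc cP P0 F0 dF DR _ L0 sm [Ps _].
have nL0 : 0 <= n%:R * L by rewrite mulr_ge0.
have bound T x T0 run := @FW_Dis_bound R n P F gradF L xstar T x
  Pc cP P0 F0 dF DR L0 sm Ps T0 run.
have lnT T : (0 < T)%N -> ln T%:R <= harmonic_number R T.
  move=> T0; apply: le_trans (ln_le_harmonic_number R T).
  by rewrite ler_ln ?posrE ?ltr0n // ler_nat.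
split=> [T x T2 run|eps eps0].
  have T0 : (0 < T)%N by apply: leq_trans T2.
  apply: le_trans (bound T x T0 run); rewrite lerD2l lerN2 mul1r.
  have l0 : 0 < ln T%:R :> R by rewrite ln_gt0 // ltr1n.
  rewrite ler_wpM2l // lef_pV2 ?posrE ?exprn_gt0 ?harmonic_number_gt0 //.
  by rewrite ler_pXn2r ?nnegrE ?harmonic_number_ge0 ?(ltW l0) ?lnT.
pose s := Num.sqrt (n%:R * L / eps).
have s0 : 0 <= s by rewrite sqrtr_ge0.
have /andP[tr1 tr2] := truncn_itv (expR_ge0 s).
exists (Num.truncn (expR s)).+1; split => //.
  have : 1 <= expR s by rewrite -expR0 ler_expR.
  by rewrite -natr1 -/s; lra.
move=> T x NT run; have T0 : (0 < T)%N by apply: leq_trans NT.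
(* What remains is [s <= H_T], which follows from [expR s < N <= T] and [ln T <= H_T]. *)
apply: le_trans (bound T x T0 run); rewrite lerD2l lerN2.
have H0 := harmonic_number_gt0 R T0.
rewrite ler_pdivrMr ?exprn_gt0 // -ler_pdivrMl // mulrC.
have <- : s ^+ 2 = n%:R * L / eps by rewrite sqr_sqrtr // divr_ge0 // ltW.
rewrite ler_pXn2r ?nnegrE ?(ltW H0) // (le_trans _ (lnT T T0)) //.
rewrite -[s]expRK ler_ln ?posrE ?expR_gt0 ?ltr0n //.
by rewrite (le_trans (ltW tr2)) // ler_nat.
Qed.
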